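(* For every integer $k\ge1$ and all positive integers $a, b_1,\dots,b_{2^k}$, $$ S_{2^k}(a;b_1,\dots,b_{2^k}) \le \left(\prod_{j=1}^{2^k} M_{2^k}(a;b_j)\right)^{1/2^k}. $$
   Context: For positive integers $a,b,b_1,\dots,b_d$ and $r\ge 1$: $S_d(a;b_1,\dots,b_d) = \frac1a\sum_{m=0}^{a-1}\left\lfloor\frac{mb_1}a\right\rfloor\cdots\left\lfloor\frac{mb_d}a\right\rfloor$ and $M_r(a;b) = \frac1a\sum_{m=0}^{a-1}\left\lfloor\frac{mb}a\right\rfloor^r$. *)

(* Defs.v *)
From mathcomp Require Import all_boot all_order all_algebra.
From mathcomp Require Import all_classical all_reals all_analysis.

Set Implicit Arguments.
Unset Strict Implicit.
Unset Printing Implicit Defensive.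
Import Order.TTheory GRing.Theory Num.Theory.
Local Open Scope ring_scope.

Section FloorSums.
Variable R : realType.

Definition floor_quot (a m b : nat) : R :=
  (Num.floor ((m%:R * b%:R) / a%:R : R))%:~R.

(* [floor_sum a b] is S_d(a; b_1, ..., b_d), where [b j] stands for b_(j+1),
   and [floor_moment r a b] is M_r(a; b). *)
Definition floor_sum (d a : nat) (b : 'I_d -> nat) : R :=
  a%:R^-1 * \sum_(0 <= m < a) \prod_(j < d) floor_quot a m (b j).

Definition floor_moment (r a b : nat) : R :=
  a%:R^-1 * \sum_(0 <= m < a) floor_quot a m b ^+ r.

End FloorSums.

(* Main.v *)
Require Import Defs.
From mathcomp Require Import all_boot all_order all_algebra.
From mathcomp Require Import all_classical all_reals all_analysis.

Set Implicit Arguments.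
Unset Strict Implicit.
Unset Printing Implicit Defensive.
Import Order.TTheory GRing.Theory Num.Theory.
Local Open Scope ring_scope.

(** The inequality is Hölder's inequality for [n = 2 ^ k] nonnegative functions
    with all exponents equal to [n], applied to the functions
    [m |-> floor (m b_j / a)] and the averaging weights [1 / a].

    Hölder's inequality follows from the inequality between arithmetic and
    geometric means ([prod_le_mean_expn]): once each function [f_j] is divided by
    its norm [c_j = (\sum_i w_i f_j(i) ^ n) ^ (1 / n)], the product at each point
    is at most the mean of the [n]-th powers, and the weighted sum of each of
    these powers is [1].  Hence the weighted sum of the normalised products is
    at most [1], which is the claim ([weighted_holder]).  The case [c_j = 0],
    where dividing is impossible, makes the left-hand side vanish. *)

(** The arithmetic-geometric mean inequality bounds the product of the
    [g j ^+ n] by an [n]-th power; taking [n]-th roots gives a form which is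
    linear in the [g j ^+ n], hence can be summed over a parameter. *)
Lemma prod_le_mean_expn (R : realFieldType) (J : finType) (g : J -> R) :
  (0 < #|J|)%N -> (forall j, 0 <= g j) ->
  \prod_j g j <= (\sum_j g j ^+ #|J|) / #|J|%:R.
Proof.
move=> J0 g0.
rewrite -(ler_pXn2r J0) ?nnegrE ?prodr_ge0 //; last first.
  by rewrite divr_ge0 ?sumr_ge0 // => j _; rewrite exprn_ge0.
rewrite -prodrXl.
have E0 : {in J, forall j, 0 <= g j ^+ #|J|} by move=> j _; rewrite exprn_ge0.
by have [] := leif_AGM E0.
Qed.

(** Hölder's inequality with equal exponents: normalising every [f j] to norm
    [1] makes the mean over [j] of the sums produced by [prod_le_mean_expn]
    equal to [1].  With weights, a sum and an average are covered at once, so no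
    power of the averaging factor has to be tracked. *)
Lemma weighted_holder (R : realType) (I : eqType) (J : finType) (s : seq I)
    (w : I -> R) (f : J -> I -> R) :
  (0 < #|J|)%N -> (forall i, 0 <= w i) -> (forall j i, 0 <= f j i) ->
  \sum_(i <- s) w i * \prod_j f j i <=
  (\prod_j \sum_(i <- s) w i * f j i ^+ #|J|) `^ (1 / #|J|%:R).
Proof.
move=> J0 w0 f0; set n := #|J|.
have n0 : n%:R != 0 :> R by rewrite pnatr_eq0 -lt0n.
pose A j := \sum_(i <- s) w i * f j i ^+ n.
have wf0 j i : 0 <= w i * f j i ^+ n by rewrite mulr_ge0 ?exprn_ge0.
have A0 j : 0 <= A j by apply: sumr_ge0 => i _; exact: wf0.
have [/existsP[j0 /eqP Aj0]|/existsPn An0] := boolP [exists j, A j == 0].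
  (* A function of norm zero vanishes wherever the weight does not. *)
  rewrite big_seq big1 ?powR_ge0 // => i si; apply/eqP.
  have /eqP := Aj0; rewrite psumr_eq0; last by move=> ? _; exact: wf0.
  move=> /allP /(_ _ si); rewrite /= mulf_eq0 expf_eq0 J0 /= => /orP[/eqP->|/eqP fj0].
    by rewrite mul0r.
  by rewrite (bigD1 j0) //= fj0 mul0r mulr0.
pose c j := A j `^ n%:R^-1.
have c0 j : 0 < c j by rewrite powR_gt0 // lt_neqAle eq_sym An0 A0.
have cn j : c j ^+ n = A j.
  by rewrite -powR_mulrn ?powR_ge0 // -powRrM mulVf // powRr1.
have -> : (\prod_j A j) `^ (1 / n%:R) = \prod_j c j.
  have P0 : 0 <= \prod_j c j by apply: prodr_ge0 => j _; exact: ltW.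
  rewrite div1r (eq_bigr (fun j => c j ^+ n)) => [|j _]; last by rewrite cn.
  by rewrite prodrXl -powR_mulrn // -powRrM mulfV // powRr1.
have C0 : 0 < \prod_j c j by apply: prodr_gt0 => j _; exact: c0.
rewrite -[leRHS]mul1r -ler_pdivrMr // mulr_suml.
have step i : w i * \prod_j f j i / \prod_j c j <=
    n%:R^-1 * \sum_j (w i * f j i ^+ n) / A j.
  rewrite -mulrA -prodf_div.
  have g0 j : 0 <= f j i / c j by rewrite divr_ge0 // ltW.
  apply: (le_trans (ler_wpM2l (w0 i) (prod_le_mean_expn J0 g0))).
  rewrite mulrA mulrC ler_wpM2l ?invr_ge0 //.
  rewrite mulr_sumr; apply: ler_sum => j _.
  by rewrite exprMn exprVn cn mulrA.
apply: (le_trans (ler_sum _ (fun i _ => step i))).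
rewrite -mulr_sumr exchange_big /=.
rewrite (eq_bigr (fun=> 1)) => [|j _]; last by rewrite -mulr_suml divff ?An0.
by rewrite sumr_const mulVf.
Qed.

Lemma floor_quot_ge0 (R : realType) (a m b : nat) : 0 <= floor_quot R a m b.
Proof. by rewrite /floor_quot ler0z floor_ge0 divr_ge0 ?mulr_ge0. Qed.

Theorem lemma11 (R : realType) (k : nat) (hk : (1 <= k)%N)
    (a : nat) (ha : (0 < a)%N)
    (b : 'I_(2 ^ k) -> nat) (hb : forall j, (0 < b j)%N) :
  floor_sum R a b
    <= (\prod_(j < 2 ^ k) floor_moment R (2 ^ k) a (b j)) `^ (1 / (2 ^ k)%:R).
Proof.
have J0 : (0 < #|'I_(2 ^ k)|)%N by rewrite card_ord expn_gt0.
have w0 (m : nat) : 0 <= a%:R^-1 :> R by rewrite invr_ge0.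
have := weighted_holder (index_iota 0 a) J0 w0
  (fun j m => floor_quot_ge0 R a m (b j)).
rewrite card_ord -mulr_sumr; congr (_ <= _ `^ _).
by apply: eq_bigr => j _; rewrite -mulr_sumr.
Qed.
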